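(* There exists $b_0$ such that the following holds. Let $a,b,c$ be positive integers with $a\leq b\leq c\leq b^{1.01}$, $b\geq b_0$, $\gcd(b,c)=1$ and $c\neq a+b$. Then there is a constant $\kappa>0$ such that for every positive integer $N$ there exists a set $A\subseteq\{1,2,\dots,N\}$ with $|A|\geq \kappa N^{1/4.77}$ such that $A$ contains no non-trivial solutions to the equation $ax+by+cz=ax'+by'+cz'$.
   Context: A solution $(x,y,z,x',y',z')$ (all variables in $A$) of $ax+by+cz=ax'+by'+cz'$ is trivial if, viewing the equation as $ax+by+cz-ax'-by'-cz'=0$, for every value $\alpha$ the coefficients of those variables taking the value $\alpha$ sum to zero. A solution is non-trivial if it is not trivial. *)

(* Defs.v *)
From mathcomp Require Import all_boot all_order all_algebra finmap.
From mathcomp Require Import all_classical all_reals all_analysis.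

Set Implicit Arguments.
Unset Strict Implicit.
Unset Printing Implicit Defensive.

Import Order.TTheory GRing.Theory Num.Theory.
Local Open Scope ring_scope.

Section Equation.
Variables (a b c : nat) (x y z x' y' z' : nat).

Definition solution : Prop :=
  (a * x + b * y + c * z = a * x' + b * y' + c * z')%N.

(* The (coefficient, value) pairs of ax + by + cz - ax' - by' - cz' = 0. *)
Definition signed_terms : seq (int * nat) :=
  [:: (a%:Z, x); (b%:Z, y); (c%:Z, z);
      (- a%:Z, x'); (- b%:Z, y'); (- c%:Z, z')].

Definition trivial : Prop :=
  forall alpha : nat, \sum_(t <- signed_terms | t.2 == alpha) t.1 = 0.

Definition nontrivial_solution : Prop := solution /\ ~ trivial.

End Equation.

Definition no_nontrivial_solutions (a b c : nat) (A : {fset nat}) : Prop :=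
  forall x y z x' y' z' : nat,
    x \in A -> y \in A -> z \in A -> x' \in A -> y' \in A -> z' \in A ->
    ~ nontrivial_solution a b c x y z x' y' z'.

(* Main.v *)
(* Suppose first a < b, and let T be about b^0.27. If the lattice
   {v in Z^3 : a v1 + b v2 + c v3 = 0} has no nonzero point with coordinates
   below T, the digit set [0, T) has no non-trivial solution. Otherwise let v be
   such a point and L about b / 2T. As gcd(b, c) = 1, the cross product of v with
   any other lattice point is an integer multiple of (a, b, c), so every lattice
   point with coordinates below L is parallel to v. As a < b <= c and c <> a + b, two
   nonzero coordinates of v have distinct absolute values; let r / s be their
   ratio in lowest terms and P = max(r, s). The integers below L whose base-P
   digits in odd positions vanish number at least sqrt L, and their differences
   have even P-adic valuation, so that two nonzero differences are never in the
   ratio r / s. Hence this digit set has no non-trivial solution. In both cases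
   numbers written in base q = 3cT or 3cL with these digits add without carry,
   and the exponent log |D| / log q exceeds 1 / 4.77.

   If a = b, then since b and c are coprime, rereading in base
   3cb the base-b digits of the elements of a Sidon set S yields a set in which
   a solution satisfies z = z' and x + y = x' + y' in S. A Sidon set in [0, M)
   of size M^(7/16) is obtained from {(t, t^2) : t in F_(p^n)}. *)

Require Import Defs.
From mathcomp Require Import all_boot all_order all_algebra finmap all_field.
From mathcomp Require Import all_classical all_reals all_analysis.
From mathcomp Require Import zify ring lra.

Set Implicit Arguments.
Unset Strict Implicit.
Unset Printing Implicit Defensive.

Import Order.TTheory GRing.Theory Num.Theory.
Local Open Scope ring_scope.
Local Open Scope nat_scope.

(** * Digit expansions *)

Fixpoint digit_seq (q : nat) (D : seq nat) (k : nat) : seq nat :=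
  if k is k'.+1 then [seq d + q * e | d <- D, e <- digit_seq q D k']
  else [:: 0].

Lemma digit_split q d d' e e' : d < q -> d' < q ->
  d + q * e = d' + q * e' -> d = d' /\ e = e'.
Proof. 
move=> dq dq' /[dup] + /(congr1 (modn^~ q)).
rewrite ![q * _]mulnC ![_ + _ * q]addnC.
rewrite !modnMDl !modn_small // => /[swap] -> /addIn /eqP.
by rewrite eqn_pmul2r ?(leq_ltn_trans _ dq') // => /eqP. Qed.

Lemma size_digit_seq q D k : size (digit_seq q D k) = size D ^ k.
Proof. by elim: k => //= k IHk; rewrite size_allpairs IHk expnS. Qed.

Lemma digit_seq_uniq q D k :
  {in D, forall d, d < q} -> uniq D -> uniq (digit_seq q D k).
Proof.
move=> Dq uD; elim: k => //= k IHk.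
apply: allpairs_uniq => // -[d e] [d' e'] /allpairsP[[u v] /= [uD' _ [-> ->]]].
case/allpairsP=> -[u' v'] /= [uD'' _ [-> ->]] /digit_split[]; try exact: Dq.
by move=> -> ->.
Qed.

Lemma digit_seq_lt q D k n :
  {in D, forall d, d < q} -> n \in digit_seq q D k -> n < q ^ k.
Proof.
move=> Dq; elim: k n => [|k IHk] n /=; first by rewrite inE => /eqP->.
case/allpairsP=> -[d e] /= [/Dq dq /IHk eq ->].
by rewrite expnS; apply: leq_trans (leq_mul (leqnn q) eq); rewrite mulnS ltn_add2r.
Qed.

(** This is stronger than having only trivial solutions, and it passes digit by digit from [D] to
    [digit_seq q D k]. *)
Definition determined (a b c : nat) (S : seq nat) : Prop :=
  {in S & S & S, forall x y z, {in S & S & S, forall x' y' z',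
    solution a b c x y z x' y' z' -> [/\ x = x', y = y' & z = z']}}.

(** Each side, evaluated on single digits, stays below [q]. Nothing is carried, so the equation
    splits into one equation per digit. *)
Lemma digit_seq_determined a b c q D k :
    {in D, forall d, (a + b + c) * d < q} ->
  determined a b c D -> determined a b c (digit_seq q D k).
Proof.
move=> Dq detD; elim: k => [|k IHk] x y z /=.
  by rewrite !inE => /eqP-> /eqP-> /eqP-> x' y' z';
    rewrite !inE => /eqP-> /eqP-> /eqP->.
case/allpairsP=> -[d1 e1] /= [D1 A1 ->] /allpairsP[[d2 e2] /= [D2 A2 ->]].
case/allpairsP=> -[d3 e3] /= [D3 A3 ->] x' y' z'.
case/allpairsP=> -[d1' e1'] /= [D1' A1' ->] /allpairsP[[d2' e2'] /= [D2' A2' ->]].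
case/allpairsP=> -[d3' e3'] /= [D3' A3' ->]; rewrite /solution => E.
have lt_q u v w : u \in D -> v \in D -> w \in D -> a * u + b * v + c * w < q.
  move=> /Dq uq /Dq vq /Dq wq; pose m := maxn u (maxn v w).
  have mq : (a + b + c) * m < q by rewrite /m /maxn; do 2 case: ifP.
  by apply: leq_ltn_trans mq; rewrite !mulnDl !leq_add // leq_mul2l !leq_max leqnn ?orbT.
have [|E0 E1] := @digit_split q _ _ (a * e1 + b * e2 + c * e3)
    (a * e1' + b * e2' + c * e3') (lt_q _ _ _ D1 D2 D3) (lt_q _ _ _ D1' D2' D3').
  have split_sum u v w u' v' w' :
      a * u + b * v + c * w + q * (a * u' + b * v' + c * w') =
      a * (u + q * u') + b * (v + q * v') + c * (w + q * w') by ring.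
  by rewrite !split_sum.
by have [-> -> ->] := detD _ _ _ D1 D2 D3 _ _ _ D1' D2' D3' E0;
  have [-> -> ->] := IHk _ _ _ A1 A2 A3 _ _ _ A1' A2' A3' E1.
Qed.

(** * Sets whose differences have even valuation *)

Definition even_val (P m : nat) : Prop :=
  m = 0 \/ exists i, (P ^ i.*2 %| m) && ~~ (P ^ i.*2.+1 %| m).

(** Coprimality gives [m = k * r] and [n = k * s]. The [s]-adic valuation of [m] is that of [k],
    while that of [n] is one more, so for [k > 0] they cannot both be even. *)
Lemma even_val_coprime r s m n : 1 < s -> coprime s r ->
  even_val s m -> even_val s n -> m * s = n * r -> m = 0.
Proof.
move=> s_gt1 cop_sr + + E.
have s_gt0 : 0 < s by apply: ltnW.
have cop k : coprime (s ^ k) r by rewrite coprimeXl.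
have [k Em] : exists k, m = k * r.
  apply/dvdnP; rewrite -(@Gauss_dvdl _ _ s) 1?coprime_sym // E.
  exact: dvdn_mull.
rewrite {m}Em in E *; have [->|r_gt0] := posnP r; first by rewrite muln0.
have En : n = k * s.
  by apply/eqP; rewrite -(eqn_pmul2r r_gt0) -E mulnAC.
case=> [->//|[i]]; rewrite !Gauss_dvdl // => /andP[dvd_i ndvd_i].
rewrite En; case=> [/eqP|[j]].
  by rewrite muln_eq0 [s == 0]gtn_eqF // orbF => /eqP->.
rewrite [s ^ _.+1]expnSr dvdn_pmul2r // => /andP[dvd_j ndvd_j].
have lt_ij : i < j.
  rewrite -ltn_double ltnNge; apply: contra ndvd_j => le_ji.
  exact: dvdn_trans (dvdn_exp2l _ le_ji) dvd_i.
case: j => // j in dvd_j ndvd_j lt_ij *; case/negP: ndvd_i.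
move: dvd_j; rewrite doubleS expnSr dvdn_pmul2r //; apply: dvdn_trans.
by rewrite dvdn_exp2l // ltnS leq_double.
Qed.

(** Base [P ^ 2] with digits below [P] is base [P] with zeros in the odd positions. The lowest
    digits in which [x] and [y] differ sit in an even position, and their difference is not
    divisible by [P]. *)
Lemma even_digits_val P k x y :
    1 < P -> x \in digit_seq (P ^ 2) (iota 0 P) k ->
  y \in digit_seq (P ^ 2) (iota 0 P) k -> even_val P (absz (x%:Z - y%:Z)%R).
Proof.
move=> P_gt1; have P_gt0 : 0 < P by apply: ltnW.
wlog le_yx : x y / y <= x => [th|] xA yA.
  by case/orP: (leq_total y x) => /th; [|rewrite IntDist.distnC]; apply.
rewrite IntDist.distnEl //; elim: k x y => [|k IHk] x y /= in le_yx xA yA *.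
  by move: xA yA; rewrite !inE => /eqP-> /eqP->; left.
case/allpairsP: xA => -[d e] /= []; rewrite mem_iota /= add0n => dP eA Ex.
case/allpairsP: yA => -[d' e'] /= []; rewrite mem_iota /= add0n => dP' eA' Ey.
have [Ed|ne_d] := eqVneq d d'; last first.
  right; exists 0; rewrite expn0 dvd1n expn1 /= -eqn_mod_dvd // Ex Ey.
  by rewrite -mulnn ![P * P * _]mulnAC ![_ + _ * P]addnC !modnMDl !modn_small.
have le_e : e' <= e.
  by move: le_yx; rewrite Ex Ey Ed leq_add2l leq_pmul2l // expn_gt0 P_gt0.
rewrite Ex Ey Ed subnDl -mulnBr.
case: (IHk _ _ le_e eA eA') => [->|[i]]; first by left; rewrite muln0.
by right; exists i.+1; rewrite doubleS 2!expnS mulnA mulnn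
   [P ^ _.+3]expnS [P ^ _.+2]expnS mulnA mulnn !dvdn_pmul2l // expn_gt0 P_gt0.
Qed.

(** [u] collects the base-[P] digits of [n] in even positions, [v] those in odd positions. *)
Lemma even_digits_cover P k n : 0 < P -> n < (P ^ 2) ^ k ->
  exists u v, [/\ u \in digit_seq (P ^ 2) (iota 0 P) k,
                  v \in digit_seq (P ^ 2) (iota 0 P) k & n = u + P * v].
Proof.
move=> P_gt0; elim: k n => [|k IHk] n.
  rewrite expn0 ltnS leqn0 => /eqP->; exists 0, 0.
  by rewrite muln0 /= inE.
rewrite expnS => lt_n; have q_gt0 : 0 < P ^ 2 by rewrite expn_gt0 P_gt0.
have [|u [v [uA vA En]]] := IHk (n %/ P ^ 2); first by rewrite ltn_divLR // mulnC.
exists (n %% P ^ 2 %% P + P ^ 2 * u), (n %% P ^ 2 %/ P + P ^ 2 * v); split.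
- by apply: allpairs_f; rewrite // mem_iota ltn_mod.
- by apply: allpairs_f; rewrite // mem_iota /= add0n ltn_divLR // mulnn ltn_mod.
rewrite {1}(divn_eq n (P ^ 2)) {1}(divn_eq (n %% P ^ 2) P) En; ring.
Qed.

Lemma even_val_set P L : 1 < P -> exists D : seq nat,
  [/\ uniq D, {in D, forall d, d < L}, L <= size D ^ 2
    & {in D &, forall x y, even_val P (absz (x%:Z - y%:Z)%R)}].
Proof.
move=> P_gt1; have P_gt0 : 0 < P by apply: ltnW.
have L_lt : L <= (P ^ 2) ^ L.
  by rewrite ltnW // ltn_expl // -[1]/(1 ^ 2) ltn_sqr.
pose D := [seq d <- digit_seq (P ^ 2) (iota 0 P) L | d < L].
exists D; split.
- rewrite filter_uniq // digit_seq_uniq ?iota_uniq // => d.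
  by rewrite mem_iota /= add0n => /leq_trans; apply; rewrite -mulnn leq_pmulr.
- by move=> d; rewrite mem_filter => /andP[].
- (* Every [n < L] is [u + P * v] for some [u] and [v] in [D]. *)
  rewrite -mulnn -(size_allpairs (fun u v => u + P * v)).
  rewrite -{1}(size_iota 0 L); apply: uniq_leq_size (iota_uniq _ _) _ => n.
  rewrite mem_iota /= add0n => lt_nL.
  have [u [v [uA vA En]]] := even_digits_cover P_gt0 (leq_trans lt_nL L_lt).
  have le_un : u <= n by rewrite En leq_addr.
  have le_vn : v <= n.
    by rewrite En; apply: leq_trans (leq_addl _ _); rewrite leq_pmull.
  apply/allpairsP; exists (u, v); rewrite !mem_filter uA vA En /=.
  by rewrite !(leq_ltn_trans _ lt_nL).
move=> x y; rewrite !mem_filter => /andP[_ xA] /andP[_ yA].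
exact: even_digits_val xA yA.
Qed.

(** * Short vectors of the kernel lattice *)

(** In lowest terms [m / n] is [r / s], and one of [r], [s] exceeds 1 as [m <> n]. With that one as
    the base [P], two nonzero differences of even valuation are never in the ratio [r / s]. *)
Lemma ratio_free_set m n L : 0 < m -> 0 < n -> m <> n -> exists D : seq nat,
  [/\ uniq D, {in D, forall d, d < L}, L <= size D ^ 2
    & {in D & &, forall x x' y, {in D, forall y',
       (absz (x%:Z - x'%:Z)%R) * n = (absz (y%:Z - y'%:Z)%R) * m -> x = x'}}].
Proof.
move=> m_gt0 n_gt0 ne_mn; have g_gt0 : 0 < gcdn m n by rewrite gcdn_gt0 m_gt0.
have /dvdnP[r Em] := dvdn_gcdl m n; have /dvdnP[s En] := dvdn_gcdr m n.
have cop_rs : coprime r s.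
  rewrite /coprime -(eqn_pmul2r g_gt0) muln_gcdl -Em -En mul1n //.
move: (gcdn m n) => g in g_gt0 Em En; rewrite {m}Em {n}En in m_gt0 n_gt0 ne_mn *.
have sameE i j : i * (s * g) = j * (r * g) -> i * s = j * r.
  by rewrite !mulnA => /eqP; rewrite eqn_pmul2r // => /eqP.
have dist0 x x' : absz (x%:Z - x'%:Z)%R = 0 -> x = x' by lia.
have [r_le1|r_gt1] := leqP r 1.
  have s_gt1 : 1 < s.
    move: m_gt0 n_gt0 ne_mn.
    by case: r r_le1 {cop_rs sameE} => [|[|]] //; case: s => [|[|]].
  have [D [uD ltD leD valD]] := even_val_set L s_gt1; exists D; split=> //.
  move=> x x' y xD xD' yD y' yD' /sameE E; apply: dist0.
  by apply: even_val_coprime s_gt1 _ (valD _ _ _ _) (valD _ _ _ _) E;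
     rewrite // coprime_sym.
have [D [uD ltD leD valD]] := even_val_set L r_gt1; exists D; split=> //.
move=> x x' y xD xD' yD y' yD' /sameE E; apply: dist0.
(* With base [r] the roles are exchanged: the difference of [y] and [y'] vanishes first, and that of
   [x] and [x'] follows from [s > 0]. *)
have y0 : absz (y%:Z - y'%:Z)%R = 0.
  by apply: even_val_coprime r_gt1 cop_rs (valD _ _ _ _) (valD _ _ _ _) (esym E).
move/eqP: E; rewrite y0 muln_eq0 => /orP[/eqP//|].
by move: n_gt0; rewrite muln_gt0; case: s {cop_rs ne_mn sameE}.
Qed.

Local Open Scope ring_scope.

Lemma coprime_small_eq0 (b c : nat) (X Y : int) :
  coprime b c -> b%:Z * X = c%:Z * Y -> (absz X < c)%N -> X = 0.
Proof.
move=> cop_bc /(congr1 absz); rewrite !abszM !absz_nat => E lt_Xc.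
have : (c %| absz X)%N.
  by rewrite -(@Gauss_dvdr _ b) 1?coprime_sym // E dvdn_mulr.
by apply/contraTeq => nzX; rewrite gtnNdvd // absz_gt0.
Qed.

(** Eliminating [a] relates two components of the cross product of [v] and [w] by [b * X = c * Y].
    The size bounds give [|X| < 2 * T * L <= c], so coprimality forces [X = 0] and then [Y = 0]. *)
Lemma kernel_parallel (a b c T L : nat) (v1 v2 v3 w1 w2 w3 : int) :
    coprime b c -> (0 < c)%N -> (b <= c)%N -> (2 * T * L <= b)%N ->
    (absz v1 < T)%N -> (absz v2 < T)%N ->
    (absz w1 < L)%N -> (absz w2 < L)%N ->
    a%:Z * v1 + b%:Z * v2 + c%:Z * v3 = 0 ->
    a%:Z * w1 + b%:Z * w2 + c%:Z * w3 = 0 ->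
  w1 * v2 = w2 * v1 /\ w1 * v3 = w3 * v1.
Proof.
move=> cop_bc c_gt0 le_bc le_b v1T v2T w1L w2L Ev Ew.
have E : b%:Z * (w1 * v2 - w2 * v1) = c%:Z * (w3 * v1 - w1 * v3).
  have Ebv : b%:Z * v2 = - a%:Z * v1 - c%:Z * v3 by lia.
  have Ebw : b%:Z * w2 = - a%:Z * w1 - c%:Z * w3 by lia.
  have -> : b%:Z * (w1 * v2 - w2 * v1) = w1 * (b%:Z * v2) - v1 * (b%:Z * w2) by ring.
  by rewrite Ebv Ebw; ring.
have X0 : w1 * v2 - w2 * v1 = 0.
  apply: coprime_small_eq0 cop_bc E _; apply: leq_trans le_bc; apply: leq_trans le_b.
  have bound (x y : int) : (absz x < L -> absz y < T -> absz (x * y)%R < T * L)%N.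
    by move=> xL yT; rewrite abszM mulnC ltn_mul.
  by have := bound _ _ w1L v2T; have := bound _ _ w2L v1T; lia.
move: E; rewrite X0 mulr0 => /esym/eqP; rewrite mulf_eq0 => /orP[|/eqP] E; lia.
Qed.

(** Otherwise [v] is [v1] times [(1, e2, e3)] with [e2], [e3] in [{0, 1, -1}], so
    [a + e2 * b + e3 * c = 0]. Given [0 < a < b <= c], the only way is [c = a + b]. *)
Lemma kernel_ratio (a b c : nat) (v1 v2 v3 : int) :
    (0 < a)%N -> (a < b)%N -> (b <= c)%N -> c <> (a + b)%N -> v1 != 0 ->
    a%:Z * v1 + b%:Z * v2 + c%:Z * v3 = 0 ->
  (v2 != 0 /\ absz v1 <> absz v2) \/ (v3 != 0 /\ absz v1 <> absz v3).
Proof.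
move=> a_gt0 lt_ab le_bc ne_c v1n0 E.
have same_abs v : ~ (v != 0 /\ absz v1 <> absz v) ->
    exists2 e : int, v = e * v1 & [\/ e = 0, e = 1 | e = -1].
  have [->|v_n0 h] := eqVneq v 0.
    by exists 0; [rewrite mul0r|constructor 1].
  have Ev : absz v1 = absz v by apply: contrapT => ne; apply: h.
  have [->|->] : v = v1 \/ v = - v1 by lia.
    by exists 1; [rewrite mul1r|constructor 2].
  by exists (-1); [rewrite mulN1r|constructor 3].
have [|/same_abs[e2 E2 He2]] := pselect (v2 != 0 /\ absz v1 <> absz v2); first by left.
have [|/same_abs[e3 E3 He3]] := pselect (v3 != 0 /\ absz v1 <> absz v3); first by right.
exfalso; have : (a%:Z + b%:Z * e2 + c%:Z * e3) * v1 = 0 by rewrite -E E2 E3; ring.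
move/eqP; rewrite mulf_eq0 (negPf v1n0) orbF => /eqP.
by case: He2 => ->; case: He3 => ->; lia.
Qed.

Definition kernel_vector (a b c T : nat) (v1 v2 v3 : int) : Prop :=
  [/\ (absz v1 < T)%N, (absz v2 < T)%N, [|| v1 != 0, v2 != 0 | v3 != 0]
    & a%:Z * v1 + b%:Z * v2 + c%:Z * v3 = 0].

(** The differences of the two sides of a solution form a kernel vector [w], which is parallel to
    [v]. A set avoiding the ratio of two coordinates of [v] forces [w1 = 0], and then [w = 0] since
    [v1 != 0]. *)
Lemma lattice_free_set (a b c T L : nat) (v1 v2 v3 : int) :
    (0 < a)%N -> (a < b)%N -> (b <= c)%N -> coprime b c -> c <> (a + b)%N ->
    (2 * T * L <= b)%N -> (0 < L)%N ->
    kernel_vector a b c T v1 v2 v3 ->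
  exists D : seq nat, [/\ uniq D, {in D, forall d, (d < L)%N},
    (L <= size D ^ 2)%N & determined a b c D].
Proof.
move=> a_gt0 lt_ab le_bc cop ne_c le_b L_gt0 [v1T v2T vn0 Ev].
have c_gt0 : (0 < c)%N by lia.
(* If [v1 = 0], then [c] divides [v2], which is smaller than [T <= c]; so [v2 = 0], then
   [v3 = 0]. *)
have v1n0 : v1 != 0.
  apply/eqP => v1_0; have v2_0 : v2 = 0.
    apply: (@coprime_small_eq0 b c v2 (- v3)) => //; first by lia.
    by apply: leq_trans v2T _; nia.
  by move: vn0 Ev; rewrite v1_0 v2_0 !eqxx /= !mulr0 !add0r => v3n0 /eqP;
    rewrite mulf_eq0 (negPf v3n0) orbF; lia.
pose t := if (v2 != 0) && (absz v1 != absz v2) then v2 else v3.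
have [tn0 ne_t] : t != 0 /\ absz v1 <> absz t.
  rewrite /t; have := kernel_ratio a_gt0 lt_ab le_bc ne_c v1n0 Ev.
  by case: ifP => [/andP[n0 /eqP]|] //; lia.
have [D [uD ltD leD ratioD]] := @ratio_free_set (absz v1) (absz t) L
  (ltac:(lia)) (ltac:(lia)) ne_t.
exists D; split=> // x y z xD yD zD x' y' z' xD' yD' zD' sol.
have dist_lt u u' : u \in D -> u' \in D -> (absz (u%:Z - u'%:Z)%R < L)%N.
  by move=> /ltD uL /ltD uL'; lia.
have Ew : a%:Z * (x%:Z - x'%:Z) + b%:Z * (y%:Z - y'%:Z) + c%:Z * (z%:Z - z'%:Z) = 0.
  by move: sol; rewrite /solution; lia.
have [P2 P3] := kernel_parallel cop c_gt0 le_bc le_b v1T v2T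
  (dist_lt _ _ xD xD') (dist_lt _ _ yD yD') Ev Ew.
have Ex : x = x'.
  move: ratioD; rewrite /t; case: ifP => _ ratioD.
    by apply: (ratioD x x' y xD xD' yD y' yD'); rewrite -!abszM P2.
  by apply: (ratioD x x' z xD xD' zD z' zD'); rewrite -!abszM P3.
have cancel_v1 u u' : (u%:Z - u'%:Z) * v1 = 0 -> u = u'.
  by move/eqP; rewrite mulf_eq0 (negPf v1n0) orbF; lia.
by split=> //; apply: cancel_v1; [rewrite -P2|rewrite -P3]; rewrite Ex subrr mul0r.
Qed.

(** * Sidon sets *)

Local Open Scope nat_scope.

Definition sidon (S : seq nat) : Prop :=
  {in S & S, forall x y, {in S & S, forall x' y',
    x + y = x' + y' -> x = x' /\ y = y' \/ x = y' /\ y = x'}}.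

Definition of_digits (q n : nat) (u : 'I_n -> nat) : nat :=
  \sum_(i < n) u i * q ^ i.

Lemma of_digitsS q n (u : 'I_n.+1 -> nat) :
  of_digits q u = u ord0 + q * of_digits q (u \o lift ord0).
Proof.
rewrite /of_digits big_ord_recl expn0 muln1 big_distrr; congr (_ + _).
by apply: eq_bigr => i _; rewrite /= /bump add1n expnS mulnCA.
Qed.

Lemma of_digits_lt q n (u : 'I_n -> nat) :
  (forall i, u i < q) -> of_digits q u < q ^ n.
Proof.
elim: n u => [|n IHn] u ltu; first by rewrite /of_digits big_ord0.
rewrite of_digitsS expnS.
apply: leq_trans (leq_mul (leqnn q) (IHn (u \o lift ord0) (fun i => ltu _))).
by rewrite mulnS ltn_add2r.
Qed.

Lemma of_digits_inj q n (u v : 'I_n -> nat) :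
  (forall i, u i < q) -> (forall i, v i < q) ->
  of_digits q u = of_digits q v -> u =1 v.
Proof.
elim: n u v => [|n IHn] u v ltu ltv; first by move=> _ [].
rewrite !of_digitsS => /digit_split[//|//|E0 /IHn E] i.
by case: (unliftP ord0 i) => [j|] -> //; apply: E => k; rewrite /= ?ltu ?ltv.
Qed.

Lemma of_digitsD q n (u v : 'I_n -> nat) :
  of_digits q u + of_digits q v = of_digits q (fun i => u i + v i).
Proof. by rewrite /of_digits -big_split; apply: eq_bigr => i _; rewrite mulnDl. Qed.

(** Coordinates lie below [p], so in base [2 * p] two codes add without carry, and the digits of the
    sum recover the sum of the vectors modulo [p]. *)
Lemma rV_code p n : prime p -> exists e : 'rV['F_p]_n -> nat,
  (forall x y, e x + e y < (2 * p) ^ n) /\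
  forall x y x' y', e x + e y = e x' + e y' -> (x + y = x' + y')%R.
Proof.
move=> p_pr; pose dig (v : 'rV['F_p]_n) (i : 'I_n) : nat := v ord0 i.
have dig_lt v i : dig v i < p by have := ltn_ord (v ord0 i); rewrite [X in _ < X]Fp_cast.
exists (fun v => of_digits (2 * p) (dig v)); split=> [x y|x y x' y'].
  rewrite of_digitsD; apply: of_digits_lt => i.
  by have := dig_lt x i; have := dig_lt y i; lia.
rewrite !of_digitsD => /of_digits_inj E; apply/rowP => i; rewrite !mxE.
have : dig x i + dig y i = dig x' i + dig y' i.
  by apply: E => j; rewrite -[2]/(1 + 1) mulnDl mul1n -addnS leq_add // ltnW.
by move/(congr1 (fun k => k%:R : 'F_p)%R); rewrite !natrD /dig !natr_Zp.
Qed.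

(** As an additive group the field with [p ^ n] elements is [n]-dimensional over [F_p], so the code
    of row vectors transfers along a linear isomorphism. *)
Lemma finField_code p n : prime p -> 0 < n ->
  exists (F : finFieldType) (e : F -> nat),
  [/\ p \in [pchar F]%R, #|F| = p ^ n, forall x y, e x + e y < (2 * p) ^ n &
   forall x y x' y', e x + e y = e x' + e y' -> (x + y = x' + y')%R].
Proof.
move=> p_pr n_gt0; have [F pF cardF] := pPrimePowerField p_pr n_gt0.
have [f linf [g fK gK]] := pprimeChar_vectAxiom pF.
rewrite cardF pfactorK // in f linf g fK gK.
have [e [e_lt e_add]] := rV_code n p_pr.
exists F, (fun t => e (f t)); split=> // x y x' y' /e_add.
have fD u v : f (u + v)%R = (f u + f v)%R.
  by have := linf 1%R u v; rewrite !scale1r.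
by rewrite -!fD => /(can_inj fK).
Qed.

(** Substituting [y = x' + y' - x] turns the difference of the sums of squares into
    [2 * (x - x') * (x - y')]. *)
Lemma parabola_sidon (F : fieldType) (x y x' y' : F) : (2%:R != 0 :> F)%R ->
  (x + y = x' + y' -> x ^+ 2 + y ^+ 2 = x' ^+ 2 + y' ^+ 2 ->
  x = x' /\ y = y' \/ x = y' /\ y = x')%R.
Proof.
move=> two_n0 E1 E2; have Ey : (y = x' + y' - x)%R by rewrite -E1 addrC addKr.
have : (2%:R * ((x - x') * (x - y')) = 0)%R.
  transitivity (x ^+ 2 + y ^+ 2 - (x' ^+ 2 + y' ^+ 2))%R.
    by rewrite Ey; ring.
  by rewrite E2 subrr.
move/eqP; rewrite !mulf_eq0 (negPf two_n0) !subr_eq0 /= => /orP[] /eqP Ex; [left|right].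
  by split=> //; rewrite Ey Ex addrC addKr.
by split=> //; rewrite Ey Ex addrK.
Qed.

(** The point [(t, t ^ 2)] of the parabola is packed into one number as two digits in base
    [(2 * p) ^ n]. *)
Lemma sidon_prime_power p n : prime p -> 2 < p ->
  exists S : seq nat, [/\ uniq S, size S = p ^ n,
    {in S, forall s, s < ((2 * p) ^ 2) ^ n} & sidon S].
Proof.
(* There is no field with [p ^ 0 = 1] element; a singleton serves for [n = 0]. *)
move=> p_pr p_gt2; case: (posnP n) => [->|n_gt0].
  exists [:: 0]; split=> // [s|x y]; first by rewrite inE => /eqP->.
  by rewrite !inE => /eqP-> /eqP-> x' y'; rewrite !inE => /eqP-> /eqP->; left.
have [F [e [pF cardF e_lt e_add]]] := finField_code p_pr n_gt0.
pose code t := e t + (2 * p) ^ n * e (t ^+ 2)%R.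
have two_n0 : (2%:R != 0 :> F)%R.
  by rewrite -(dvdn_pcharf pF); apply: contraTN p_gt2 => /dvdn_leq; rewrite -leqNgt; apply.
have codeP x y x' y' : code x + code y = code x' + code y' ->
    x = x' /\ y = y' \/ x = y' /\ y = x'.
  have codeD u v : code u + code v =
      (e u + e v) + (2 * p) ^ n * (e (u ^+ 2)%R + e (v ^+ 2)%R).
    by rewrite /code; ring.
  rewrite !codeD => /digit_split[//|//|/e_add E1 /e_add E2].
  exact: parabola_sidon two_n0 E1 E2.
have code_inj : injective code.
  by move=> x y Exy; case: (codeP x x y y) => [|[]|[]] //; rewrite Exy.
exists [seq code t | t <- enum F]; split.
- by rewrite map_inj_uniq ?enum_uniq.
- by rewrite size_map -cardE.
- move=> s /mapP[t _ ->]; rewrite -mulnn expnMn.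
  have lt_e u : e u < (2 * p) ^ n by apply: leq_ltn_trans (e_lt u u); rewrite leq_addr.
  have le_q : (2 * p) ^ n * (e (t ^+ 2)%R).+1 <= (2 * p) ^ n * (2 * p) ^ n.
    by rewrite leq_mul.
  by apply: leq_trans le_q; rewrite mulnS /code ltn_add2r.
by move=> _ _ /mapP[x _ ->] /mapP[y _ ->] _ _ /mapP[x' _ ->] /mapP[y' _ ->]
  /codeP[] [-> ->]; [left|right].
Qed.

(** * Equal coefficients: rereading digits in a larger base *)

Fixpoint rebase (b q k n : nat) : nat :=
  if k is k'.+1 then n %% b + q * rebase b q k' (n %/ b) else 0.

Lemma rebase_lt b q k n : 0 < b -> b <= q -> rebase b q k n < q ^ k.
Proof.
move=> b_gt0 le_bq; elim: k n => //= k IHk n; rewrite expnS.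
apply: leq_trans (leq_mul (leqnn q) (IHk (n %/ b))).
by rewrite mulnS ltn_add2r (leq_trans _ le_bq) // ltn_mod.
Qed.

(** Modulo [b] only [c * d3] and [c * d3'] remain. As [c] is invertible there and both digits are
    below [b], they agree, and the rest is divided by [b]. *)
Lemma digit_reflect b c d1 d2 d3 d1' d2' d3' : coprime b c -> 0 < b ->
    d3 < b -> d3' < b ->
    b * d1 + b * d2 + c * d3 = b * d1' + b * d2' + c * d3' ->
  d1 + d2 = d1' + d2' /\ d3 = d3'.
Proof.
move=> cop b_gt0 lt_d lt_d' E; have Ed : d3 = d3'.
  apply/eqP; rewrite -eqz_nat -subr_eq0; apply/eqP.
  apply: (@coprime_small_eq0 c b _ (d1'%:Z + d2'%:Z - d1%:Z - d2%:Z)%R); last lia.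
    by rewrite coprime_sym.
  by lia.
split=> //; apply/eqP; rewrite -(eqn_pmul2l b_gt0) !mulnDr.
by move/eqP: E; rewrite Ed eqn_add2r.
Qed.

(** Nothing is carried in base [q], so the relation holds at each base-[b] digit. Equal digit sums
    in every position give [x + y = x' + y'], whatever carries occur in base [b]. *)
Lemma rebase_reflect b c q k x y z x' y' z' : coprime b c -> 0 < b ->
    (b + b + c) * b <= q ->
    x < b ^ k -> y < b ^ k -> z < b ^ k -> x' < b ^ k -> y' < b ^ k -> z' < b ^ k ->
    solution b b c (rebase b q k x) (rebase b q k y) (rebase b q k z)
      (rebase b q k x') (rebase b q k y') (rebase b q k z') ->
  x + y = x' + y' /\ z = z'.
Proof.
move=> cop b_gt0 le_q; elim: k x y z x' y' z' => [|k IHk] x y z x' y' z'.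
  by rewrite expn0 !ltnS !leqn0 => /eqP-> /eqP-> /eqP-> /eqP-> /eqP-> /eqP->.
have step n : n < b ^ k.+1 -> n %/ b < b ^ k by rewrite ltn_divLR // expnSr.
move=> /step lx /step ly /step lz /step lx' /step ly' /step lz'.
rewrite /solution /=.
have split_sum u v w u' v' w' :
  b * (u + q * u') + b * (v + q * v') + c * (w + q * w') =
  (b * u + b * v + c * w) + q * (b * u' + b * v' + c * w') by ring.
have lt_q u v w : b * (u %% b) + b * (v %% b) + c * (w %% b) < q.
  apply: leq_trans le_q; rewrite !mulnDl.
  have mb n : n %% b < b by rewrite ltn_mod.
  apply: (@leq_ltn_trans (b * b + b * (v %% b) + c * b)).
    by rewrite !leq_add // leq_mul2l ltnW ?orbT.
  by rewrite ltn_add2r ltn_add2l ltn_pmul2l.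
rewrite !split_sum => /digit_split[//|//|E0 E1].
have [Exy Ez] := digit_reflect cop b_gt0 (ltn_pmod _ b_gt0) (ltn_pmod _ b_gt0) E0.
have [Exy' Ez'] := IHk _ _ _ _ _ _ lx ly lz lx' ly' lz' E1.
rewrite (divn_eq x b) (divn_eq y b) (divn_eq z b).
rewrite (divn_eq x' b) (divn_eq y' b) (divn_eq z' b) Ez Ez'; split=> //.
by rewrite addnACA -mulnDl Exy Exy' mulnDl addnACA.
Qed.

Definition only_trivial (a b c : nat) (S : seq nat) : Prop :=
  {in S & S & S, forall x y z, {in S & S & S, forall x' y' z',
    solution a b c x y z x' y' z' -> trivial a b c x y z x' y' z'}}.

Lemma trivial_refl a b c x y z : trivial a b c x y z x y z.
Proof.
move=> alpha; rewrite /signed_terms !big_cons big_nil /=.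
by do 3 case: eqP => _; lia.
Qed.

Lemma trivial_swap b c x y z : trivial b b c x y z y x z.
Proof.
move=> alpha; rewrite /signed_terms !big_cons big_nil /=.
by do 3 case: eqP => _; lia.
Qed.

Lemma trivial_succ a b c x y z x' y' z' : trivial a b c x y z x' y' z' ->
  trivial a b c x.+1 y.+1 z.+1 x'.+1 y'.+1 z'.+1.
Proof.
move=> triv [|alpha]; rewrite /signed_terms !big_cons big_nil //=.
by have := triv alpha; rewrite /signed_terms !big_cons big_nil /= !eqSS.
Qed.

Lemma determined_only_trivial a b c S : determined a b c S -> only_trivial a b c S.
Proof.
move=> detS x y z xS yS zS x' y' z' xS' yS' zS' sol.
have [-> -> ->] := detS _ _ _ xS yS zS _ _ _ xS' yS' zS' sol.
exact: trivial_refl.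
Qed.

Lemma rebase_only_trivial b c q k S : coprime b c -> 0 < b ->
    (b + b + c) * b <= q -> {in S, forall s, s < b ^ k} -> sidon S ->
  only_trivial b b c (map (rebase b q k) S).
Proof.
move=> cop b_gt0 le_q ltS sidonS.
move=> _ _ _ /mapP[x xS ->] /mapP[y yS ->] /mapP[z zS ->].
move=> _ _ _ /mapP[x' xS' ->] /mapP[y' yS' ->] /mapP[z' zS' ->] sol.
have [Exy ->] := rebase_reflect cop b_gt0 le_q (ltS _ xS) (ltS _ yS) (ltS _ zS)
  (ltS _ xS') (ltS _ yS') (ltS _ zS') sol.
have [[-> ->]|[-> ->]] := sidonS _ _ xS yS _ _ xS' yS' Exy.
  exact: trivial_refl.
exact: trivial_swap.
Qed.

Lemma rebase_inj b c q k : coprime b c -> 0 < b -> (b + b + c) * b <= q ->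
  {in [pred n | n < b ^ k] &, injective (rebase b q k)}.
Proof.
move=> cop b_gt0 le_q x y; rewrite !inE => ltx lty E.
(* Equal images make [(x, x, x)] and [(x, x, y)] the two sides of a solution; comparing third
   entries gives [x = y]. *)
have [] := @rebase_reflect b c q k x x x x x y cop b_gt0 le_q ltx ltx ltx ltx ltx lty.
  by rewrite /solution E.
by [].
Qed.

(** * Counting *)

Local Open Scope ring_scope.

Definition many_without_solutions (R : realType) (theta : R) (a b c : nat) : Prop :=
  exists kappa : R, 0 < kappa /\
    forall N : nat, (0 < N)%N ->
      exists A : {fset nat},
        [/\ forall n : nat, n \in A -> (1 <= n <= N)%N,
            kappa * N%:R `^ theta <= #|` A|%:R
          & no_nontrivial_solutions a b c A].

Lemma ln_natM (R : realType) (m n : nat) : (0 < m)%N -> (0 < n)%N ->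
  ln ((m * n)%N%:R : R) = ln m%:R + ln n%:R.
Proof. by move=> m_gt0 n_gt0; rewrite natrM lnM ?posrE ?ltr0n. Qed.

Lemma ln_natX (R : realType) (m k : nat) : (0 < m)%N ->
  ln ((m ^ k)%N%:R : R) = k%:R * ln m%:R.
Proof. by move=> m_gt0; rewrite natrX lnXn ?ltr0n // mulr_natl. Qed.

Lemma ler_ln_nat (R : realType) (m n : nat) : (0 < m)%N -> (m <= n)%N ->
  ln (m%:R : R) <= ln n%:R.
Proof.
move=> m_gt0 le_mn; rewrite ler_ln ?posrE ?ltr0n ?ler_nat //.
exact: leq_trans le_mn.
Qed.

Lemma expR_ln_nat (R : realType) (n : nat) : (0 < n)%N -> expR (ln (n%:R : R)) = n%:R.
Proof. by move=> n_gt0; rewrite lnK // posrE ltr0n. Qed.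

(** For [q ^ k <= N < q ^ (k + 1)], the set for [k] is shifted by one into [{1, ..., N}]. Rounding
    [N] down to [q ^ k] costs at most a factor [q ^ theta], absorbed in the constant. *)
Lemma scale_up (R : realType) (theta kappa : R) (a b c q : nat) :
    (1 < q)%N -> 0 < kappa -> 0 <= theta ->
    (forall k, exists S : seq nat, [/\ uniq S, {in S, forall s, (s < q ^ k)%N},
       kappa * expR (theta * (k%:R * ln q%:R)) <= (size S)%:R
       & only_trivial a b c S]) ->
  many_without_solutions theta a b c.
Proof.
move=> q_gt1 kappa_gt0 theta_ge0 setS; have q_gt0 := ltnW q_gt1.
exists (kappa * expR (- (theta * ln q%:R))).
split=> [|N N_gt0]; first by rewrite mulr_gt0 ?expR_gt0.
have /andP[le_qN lt_Nq] := trunc_log_bounds q_gt1 N_gt0.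
set k := trunc_log q N in le_qN lt_Nq.
have [S [uS ltS sizeS trivS]] := setS k.
exists [fset n in [seq s.+1 | s <- S]]%fset.
have memA n : n \in [fset n in [seq s.+1 | s <- S]]%fset -> exists2 s, s \in S & n = s.+1.
  by rewrite in_fset => /mapP.
split=> [n /memA[s sS ->]||].
- by rewrite (leq_trans (ltS _ sS) le_qN).
- rewrite card_fseq undup_id ?map_inj_uniq // ?size_map; last exact: succn_inj.
  apply: le_trans sizeS; rewrite -mulrA ler_pM2l // /powR pnatr_eq0 gtn_eqF //.
  rewrite -expRD ler_expR.
  have : ln (N%:R : R) <= k.+1%:R * ln q%:R by rewrite -ln_natX ?ler_ln_nat // ltnW.
  rewrite -natr1 mulrDl mul1r => le_ln.
  by rewrite addrC -mulrBr ler_wpM2l // lerBlDr.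
- move=> _ _ _ _ _ _ /memA[x xS ->] /memA[y yS ->] /memA[z zS ->]
         /memA[x' xS' ->] /memA[y' yS' ->] /memA[z' zS' ->] [sol].
  apply.
  apply/trivial_succ/trivS => //.
  by move: sol; rewrite /solution !mulnS; lia.
Qed.

Lemma from_digit_set (R : realType) (theta : R) (a b c q : nat) (D : seq nat) :
    (1 < q)%N -> 0 <= theta -> uniq D -> (0 < size D)%N ->
    {in D, forall d, ((a + b + c) * d < q)%N} -> (0 < a + b + c)%N ->
    determined a b c D -> theta * ln q%:R <= ln (size D)%:R ->
  many_without_solutions theta a b c.
Proof.
move=> q_gt1 theta_ge0 uD D_gt0 ltD abc_gt0 detD le_ln.
apply: (@scale_up _ _ 1 _ _ _ q) => // k; exists (digit_seq q D k).
have ltq : {in D, forall d, (d < q)%N}.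
  by move=> d /ltD; apply: leq_ltn_trans; rewrite leq_pmull.
split.
- exact: digit_seq_uniq.
- by move=> s; apply: digit_seq_lt.
- rewrite mul1r size_digit_seq -[leRHS]expR_ln_nat ?expn_gt0 ?D_gt0 // ler_expR.
  by rewrite ln_natX // mulrCA ler_wpM2l.
- exact/determined_only_trivial/digit_seq_determined.
Qed.

Lemma ln_nat_ge0 (R : realType) (n : nat) : 0 <= ln (n%:R : R).
Proof. by case: n => [|n]; [rewrite ln0|rewrite ln_ge0 // ler1n]. Qed.

(** [3 + ln b + ln c] bounds the logarithm of the base [3 * c * b], and 7/16 is the exponent of the
    Sidon set. *)
Lemma equal_coefficients (R : realType) (theta : R) (b c : nat) :
    0 <= theta -> coprime b c -> (1 < b)%N -> (b <= c)%N ->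
    theta * (3%:R + ln b%:R + ln c%:R) <= 7%:R / 16%:R * ln b%:R ->
  many_without_solutions theta b b c.
Proof.
move=> theta_ge0 cop b_gt1 le_bc le_theta; have b_gt0 := ltnW b_gt1.
have c_gt0 : (0 < c)%N by apply: leq_trans le_bc.
(* [p >= 2 ^ 7] gives [p ^ n >= M ^ (7/16)] for [M = (2 * p) ^ (2 * n)]. *)
have [p p_gt p_pr] := prime_above 128.
have p_gt0 : (0 < p)%N by apply: prime_gt0.
have p_gt2 : (2 < p)%N by apply: leq_trans p_gt.
have q_ge : ((b + b + c) * b <= 3 * c * b)%N by rewrite leq_mul2r; lia.
have q_ge_b : (b <= 3 * c * b)%N by apply: leq_trans q_ge; rewrite leq_pmull //; lia.
(* For [n] maximal with [(2 * p) ^ (2 * n) <= b ^ k], one has [p ^ (n + 1) >= b ^ (7 * k / 16)]; the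
   factor [1 / p] pays for the missing power. *)
apply: (@scale_up _ _ (expR (- ln p%:R)) _ _ _ (3 * c * b)%N) => //.
- exact: leq_trans q_ge_b.
- exact: expR_gt0.
move=> k; pose r := ((2 * p) ^ 2)%N.
have r_gt1 : (1 < r)%N by rewrite -[1%N]/(1 ^ 2)%N ltn_sqr; lia.
have ln_r : ln (r%:R : R) = 2%:R * (ln 2%:R + ln p%:R).
  by rewrite ln_natX ?muln_gt0 // ln_natM.
have bk_gt0 : (0 < b ^ k)%N by rewrite expn_gt0 b_gt0.
have /andP[le_rb lt_br] := trunc_log_bounds r_gt1 bk_gt0.
set n := trunc_log r (b ^ k) in le_rb lt_br.
have [S [uS sizeS ltS sidonS]] := sidon_prime_power n p_pr p_gt2.
have ltSb : {in S, forall s, (s < b ^ k)%N}.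
  by move=> s /ltS lt_s; apply: leq_trans lt_s le_rb.
exists (map (rebase b (3 * c * b) k) S); split.
- rewrite map_inj_in_uniq // => x y xS yS.
  by apply: (rebase_inj cop b_gt0 q_ge); rewrite inE ltSb.
- by move=> _ /mapP[s _ ->]; apply: rebase_lt.
- rewrite size_map sizeS -[leRHS]expR_ln_nat ?expn_gt0 ?p_gt0 // -expRD ler_expR.
  rewrite ln_natX // !ln_natM ?muln_gt0 //.
  have ln3 : ln (3%:R : R) <= 3%:R by rewrite ltW // ln_sublinear.
  have ln_br : k%:R * ln (b%:R : R) <= (n%:R + 1) * (2%:R * (ln 2%:R + ln p%:R)).
    rewrite natr1 -ln_r -!ln_natX //; last exact: ltnW.
    by apply: ler_ln_nat bk_gt0 _; apply: ltnW.
  have ln2 : 7%:R * ln (2%:R : R) <= ln p%:R.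
    by rewrite -ln_natX // ler_ln_nat // ltnW.
  have n1_ge0 : 0 <= n%:R + 1 :> R by rewrite natr1.
  have := ler_wpM2l n1_ge0 ln2.
  have : theta * (k%:R * (ln 3%:R + ln c%:R + ln b%:R)) <= k%:R * (7%:R / 16%:R * ln b%:R).
    rewrite mulrCA ler_wpM2l //; apply: le_trans le_theta.
    by rewrite ler_wpM2l //; lra.
  move: ln_br; lra.
exact: rebase_only_trivial q_ge ltSb sidonS.
Qed.

(** * Distinct coefficients: choice of parameters and exponents *)

Lemma base_gt1 c M : (0 < c -> 0 < M -> 1 < 3 * c * M)%N.
Proof. by move=> c_gt0 M_gt0; rewrite -mulnA -[2%N]muln1 leq_mul ?muln_gt0 ?c_gt0. Qed.

Lemma base_no_carry a b c d M : (0 < c -> a <= c -> b <= c -> d < M ->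
  (a + b + c) * d < 3 * c * M)%N.
Proof.
move=> c_gt0 le_ac le_bc lt_d; apply: (@leq_ltn_trans (3 * c * d)).
  by rewrite leq_mul2r; lia.
by rewrite ltn_pmul2l //; lia.
Qed.

(** Rounding down a quotient that is at least 1 loses at most a factor 2. *)
Lemma le_quarter b T : (0 < T -> 2 * T <= b -> b <= 2 ^ 2 * T * (b %/ (2 * T)))%N.
Proof.
move=> T_gt0 le_Tb; have T2_gt0 : (0 < 2 * T)%N by rewrite muln_gt0.
have L_gt0 : (0 < b %/ (2 * T))%N by rewrite divn_gt0.
apply: leq_trans (ltnW (ltn_ceil b T2_gt0)) _.
move: (b %/ _)%N L_gt0 => L L_gt0.
have -> : (2 ^ 2 * T * L = (L + L) * (2 * T))%N by ring.
by rewrite leq_mul2r; lia.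
Qed.

Lemma iota_determined a b c T :
  ~ (exists v1 v2 v3, kernel_vector a b c T v1 v2 v3) -> determined a b c (iota 0 T).
Proof.
move=> no_v x y z; rewrite !mem_iota /= !add0n => xT yT zT x' y' z'.
rewrite !mem_iota /= !add0n /solution => xT' yT' zT' sol.
apply: contrapT => ne; apply: no_v.
exists (x%:Z - x'%:Z), (y%:Z - y'%:Z), (z%:Z - z'%:Z); split; [lia|lia| |lia].
apply: contra_notT ne; rewrite !negb_or !negbK !subr_eq0 !eqz_nat.
by case/and3P=> /eqP-> /eqP-> /eqP->.
Qed.

Lemma distinct_coefficients (R : realType) (theta : R) (a b c : nat) :
    0 <= theta <= 100%:R / 477%:R -> coprime b c -> (0 < a)%N -> (a < b)%N ->
    (b <= c)%N -> c <> (a + b)%N ->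
    ln c%:R <= 101%:R / 100%:R * ln (b%:R : R) -> 100%:R * 100%:R <= ln (b%:R : R) ->
  many_without_solutions theta a b c.
Proof.
move=> /andP[theta_ge0 theta_le] cop a_gt0 lt_ab le_bc ne_c le_c b_large.
have b_gt0 : (0 < b)%N by apply: leq_ltn_trans lt_ab.
have c_gt0 : (0 < c)%N by apply: leq_trans le_bc.
set B := ln b%:R in le_c b_large.
have ln2 : ln (2%:R : R) <= 2%:R by rewrite ltW // ln_sublinear.
have ln3 : ln (3%:R : R) <= 3%:R by rewrite ltW // ln_sublinear.
have le_ln (u v : R) : 0 <= u -> 100%:R * u <= 477%:R * v -> theta * u <= v.
  by move=> u_ge0 le_uv; have := ler_wpM2r u_ge0 theta_le; lra.
(* For [c = b] the two alternatives below give the same density when the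
   exponent of [T] is [2 - sqrt 3 = 0.2679...]. *)
have /andP[] := truncn_itv (expR_ge0 (27%:R / 100%:R * B)).
move: (Num.trunc _) => T le_T lt_T.
have T_gt0 : (0 < T)%N.
  rewrite lt0n; apply/eqP => T0; move: lt_T; rewrite T0 ltNge => /negP; apply.
  by rewrite -[leLHS]expR0 ler_expR; lra.
have lnT_le : ln (T%:R : R) <= 27%:R / 100%:R * B.
  by rewrite -[leRHS]expRK ler_ln // posrE ?ltr0n ?expR_gt0.
have lnT_ge : 27%:R / 100%:R * B <= ln 2%:R + ln (T%:R : R).
  rewrite -ln_natM // -[leLHS]expRK ler_ln // ?posrE ?expR_gt0 ?ltr0n ?muln_gt0 //.
  by apply: le_trans (ltW lt_T) _; rewrite ler_nat mul2n -addnn -addn1 leq_add2l.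
have lnT_ge0 := ln_nat_ge0 R T; have lnc_ge0 := ln_nat_ge0 R c.
have ln3_ge0 := ln_nat_ge0 R 3.
have abc_gt0 : (0 < a + b + c)%N by rewrite addn_gt0 c_gt0 orbT.
have lt_q M d : (d < M -> (a + b + c) * d < 3 * c * M)%N.
  exact: base_no_carry c_gt0 (leq_trans (ltnW lt_ab) le_bc) le_bc.
have [[v1 [v2 [v3 kv]]]|no_v] :=
  pselect (exists v1 v2 v3, kernel_vector a b c T v1 v2 v3); last first.
  apply: (@from_digit_set _ _ _ _ _ (3 * c * T)%N (iota 0 T)) => //.
  - exact: base_gt1.
  - exact: iota_uniq.
  - by rewrite size_iota.
  - by move=> d; rewrite mem_iota /= add0n; apply: lt_q.
  - exact: iota_determined.
  (* Up to constants the exponent is at least 0.27 / (1.01 + 0.27) = 0.2109..., above 1 / 4.77 =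
     0.2096.... *)
  by rewrite size_iota; apply: le_ln; rewrite !ln_natM ?muln_gt0 ?c_gt0 //; lra.
have le_2T : (2 * T <= b)%N.
  rewrite -(ler_nat R) -ler_ln ?posrE ?ltr0n ?muln_gt0 // ln_natM //.
  by rewrite -/B; lra.
pose L := (b %/ (2 * T))%N.
have L_gt0 : (0 < L)%N by rewrite divn_gt0 // muln_gt0.
have le_L : (2 * T * L <= b)%N by rewrite mulnC leq_trunc_div.
have lnL_ge : B <= 2%:R * ln 2%:R + ln (T%:R : R) + ln L%:R.
  by rewrite -ln_natX // -!ln_natM ?muln_gt0 ?expn_gt0 // ler_ln_nat // le_quarter.
move: L L_gt0 le_L lnL_ge => L L_gt0 le_L lnL_ge.
have [D [uD ltD leD detD]] :=
  lattice_free_set a_gt0 lt_ab le_bc cop ne_c le_L L_gt0 kv.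
have D_gt0 : (0 < size D)%N by rewrite -sqrn_gt0 (leq_trans L_gt0).
have lnD : ln (L%:R : R) <= 2%:R * ln (size D)%:R.
  by rewrite -ln_natX // ler_ln_nat.
have lnL_ge0 := ln_nat_ge0 R L.
apply: (@from_digit_set _ _ _ _ _ (3 * c * L)%N D) => //.
- exact: base_gt1.
- by move=> d /ltD; apply: lt_q.
(* Up to constants the exponent is at least 0.365 / (1.01 + 0.73) = 0.20977..., against 0.20964....
   It suffices that 138.5 ln L >= 100 (ln 3 + ln c); here the slack of 0.105 ln b outweighs the
   constants once ln b >= 10^4. *)
by apply: le_ln; rewrite !ln_natM ?muln_gt0 ?c_gt0 //; lra.
Qed.

Theorem theorem2 (R : realType) :
  exists b0 : nat, forall a b c : nat,
    (0 < a)%N -> (0 < b)%N -> (0 < c)%N ->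
    (a <= b)%N -> (b <= c)%N -> c%:R <= b%:R `^ (101%:R / 100%:R) :> R ->
    (b0 <= b)%N -> gcdn b c = 1%N -> c <> (a + b)%N ->
    exists kappa : R, 0 < kappa /\
      forall N : nat, (0 < N)%N ->
        exists A : {fset nat},
          [/\ forall n : nat, n \in A -> (1 <= n <= N)%N,
              kappa * N%:R `^ (1 / (477%:R / 100%:R)) <= #|` A|%:R
            & no_nontrivial_solutions a b c A].
Proof.
pose K : R := 100%:R * 100%:R.
(* One unit makes up for rounding down, so that [ln b >= K]; the second gives [1 < b] at once. *)
exists (Num.trunc (expR K)).+2.
move=> a b c a_gt0 b_gt0 c_gt0 le_ab le_bc le_cb le_b0 gcd1 ne_c.
have b_large : K <= ln (b%:R : R).
  rewrite -[leLHS]expRK ler_ln ?posrE ?expR_gt0 ?ltr0n //.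
  have /andP[_ /ltW] := truncn_itv (expR_ge0 K).
  by move/le_trans; apply; rewrite ler_nat; apply: leq_trans le_b0.
have le_lnc : ln (c%:R : R) <= 101%:R / 100%:R * ln b%:R.
  rewrite -ln_powR ler_ln ?posrE ?powR_gt0 ?ltr0n //.
have -> : 1 / (477%:R / 100%:R) = 100%:R / 477%:R :> R by field.
rewrite -/(many_without_solutions (100%:R / 477%:R : R) a b c).
have cop : coprime b c by rewrite /coprime gcd1.
have theta_ge0 : 0 <= 100%:R / 477%:R :> R by lra.
move: le_ab; rewrite leq_eqVlt => /orP[/eqP Eab|lt_ab]; last first.
  by apply: distinct_coefficients => //; rewrite theta_ge0 lexx.
rewrite Eab; apply: equal_coefficients => //; first by apply: leq_trans le_b0.
(* The margin is 2.01 / 4.77 = 0.421... against 7/16 = 0.4375. *)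
by rewrite /K in b_large; lra.
Qed.
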